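(* Let $R$ be a commutative ring and $n\ge 2$ an integer. Then the matrix ring $\mathbb M_n(R)$ is a UNC ring if and only if $J(R)$ is nil and $R/J(R)$ is Boolean.
   Context: Rings are associative with identity. $\mathbb M_n(R)$ is the ring of $n\times n$ matrices over $R$, and $J(R)$ is the Jacobson radical of $R$. An element $a$ of a ring $S$ is nil-clean if $a=e+b$ with $e^2=e\in S$ and $b\in S$ nilpotent ($e$ and $b$ need not commute). A ring $S$ is a UNC ring if every unit of $S$ is nil-clean. A ring is Boolean if each of its elements is idempotent. An ideal is nil if all its elements are nilpotent. *)

(* Defs.v *)
From HB Require Import structures.
From mathcomp Require Import all_boot all_order all_algebra.
From mathcomp Require Import generic_quotient ring_quotient.
From mathcomp Require Import boolp classical_sets.

Set Implicit Arguments.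
Unset Strict Implicit.
Unset Printing Implicit Defensive.

Import GRing.Theory.
Local Open Scope ring_scope.
Local Open Scope quotient_scope.
Local Open Scope classical_set_scope.

(* Rings are [pzRingType]s, so that the zero ring is allowed. Units are spelled
   out because [GRing.unit] needs a decidable unit predicate, which neither an
   arbitrary [R : comPzRingType] nor ['M[R]_n] carries. *)
Section RingNotions.
Variable S : pzRingType.

Definition is_unit (u : S) : Prop := exists v : S, u * v = 1 /\ v * u = 1.

Definition is_idempotent (e : S) : Prop := e ^+ 2 = e.

Definition is_nilpotent (b : S) : Prop := exists k : nat, b ^+ k = 0.

Definition nil_clean (a : S) : Prop :=
  exists e b : S, [/\ is_idempotent e, is_nilpotent b & a = e + b].

Definition nil_set (I : set S) : Prop := forall x, I x -> is_nilpotent x.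

Definition left_ideal (I : set S) : Prop :=
  [/\ I 0, forall x y, I x -> I y -> I (x + y) & forall a x, I x -> I (a * x)].

Definition maximal_left_ideal (M : set S) : Prop :=
  [/\ left_ideal M, M <> setT &
      forall I : set S, left_ideal I -> M `<=` I -> I = M \/ I = setT].

(* For the zero ring the intersection is empty, hence the whole ring. *)
Definition jacobson : set S := \bigcap_(M in maximal_left_ideal) M.

End RingNotions.

Definition UNC_ring (S : pzRingType) : Prop :=
  forall u : S, is_unit u -> nil_clean u.

Definition Boolean_ring (S : pzRingType) : Prop :=
  forall x : S, is_idempotent x.

Arguments jacobson S : clear implicits.

Lemma left_ideal_jacobson (S : pzRingType) : left_ideal (jacobson S).
Proof.
split=> [M|x y Jx Jy M hM|a x Jx M hM]; first by case; case.
- by case: (hM) => -[_ MD _] _ _; apply: MD; [apply: Jx|apply: Jy].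
- by case: (hM) => -[_ _ MM] _ _; apply: MM; apply: Jx.
Qed.

(* [{ideal_quot I}] only has a ring structure for a proper ideal of a nonzero
   ring; the ring structure on R / J(R) is built here on the same underlying
   additive quotient, so as to include R = 0. *)
Section JacobsonQuotient.
Variable R : comPzRingType.

Definition jacobson_pred : R -> bool := fun x => x \in jacobson R.

Fact jacobson_zmod_closed : zmod_closed jacobson_pred.
Proof.
have [J0 JD JM] := left_ideal_jacobson R.
split=> [|x y]; first exact/mem_set.
move=> /set_mem Jx /set_mem Jy; apply/mem_set.
by rewrite -[- y]mulN1r; apply: JD => //; apply: JM.
Qed.

Definition jacobson_zmod : zmodClosed R :=
  HB.pack jacobson_pred
    (GRing.isZmodClosed.Build R jacobson_pred jacobson_zmod_closed).

Definition jacobson_quot : Type := Quotient.quot jacobson_zmod.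

HB.instance Definition _ := GRing.Zmodule.on jacobson_quot.
HB.instance Definition _ :=
  EqQuotient.copy jacobson_quot (Quotient.quot jacobson_zmod).

Lemma jacobson_quotP (x y : R) :
  \pi_jacobson_quot x = \pi_jacobson_quot y <-> jacobson R (x - y).
Proof.
split=> [/eqP|Jxy].
  by rewrite -[_ == _](Quotient.idealrBE jacobson_zmod) => /set_mem.
apply/eqP; rewrite -[_ == _](Quotient.idealrBE jacobson_zmod).
exact/mem_set.
Qed.

Lemma jacobson_quotD (x y : R) :
  \pi_jacobson_quot (x + y) = \pi_jacobson_quot x + \pi_jacobson_quot y.
Proof. exact: (Quotient.pi_add jacobson_zmod). Qed.

Definition jacobson_quot_one : jacobson_quot := \pi_jacobson_quot 1.

Definition jacobson_quot_mul := lift_op2 jacobson_quot *%R.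

Lemma jacobson_quot_piM (x y : R) :
  \pi_jacobson_quot (x * y) =
  jacobson_quot_mul (\pi_jacobson_quot x) (\pi_jacobson_quot y).
Proof.
unlock jacobson_quot_mul.
have [_ JD JM] := left_ideal_jacobson R.
have rP (z : R) : jacobson R (z - repr (\pi_jacobson_quot z)).
  by apply/jacobson_quotP; rewrite reprK.
set x' := repr (\pi_jacobson_quot x); set y' := repr (\pi_jacobson_quot y).
apply/jacobson_quotP.
have -> : x * y - x' * y' = y * (x - x') + x' * (y - y').
  by rewrite !mulrBr ![y * _]mulrC addrA subrK.
by apply: JD; apply: JM; apply: rP.
Qed.

Let piM := jacobson_quot_piM.

Fact jacobson_quot_mulA : associative jacobson_quot_mul.
Proof. by move=> x y z; rewrite -[x]reprK -[y]reprK -[z]reprK -!piM mulrA. Qed.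

Fact jacobson_quot_mulC : commutative jacobson_quot_mul.
Proof. by move=> x y; rewrite -[x]reprK -[y]reprK -!piM mulrC. Qed.

Fact jacobson_quot_mul1 : left_id jacobson_quot_one jacobson_quot_mul.
Proof. by move=> x; rewrite -[x]reprK -piM mul1r. Qed.

Fact jacobson_quot_mulDl : left_distributive jacobson_quot_mul +%R.
Proof.
move=> x y z; rewrite -[x]reprK -[y]reprK -[z]reprK.
by rewrite -jacobson_quotD -!piM -jacobson_quotD mulrDl.
Qed.

HB.instance Definition _ := GRing.Zmodule_isComPzRing.Build jacobson_quot
  jacobson_quot_mulA jacobson_quot_mulC jacobson_quot_mul1 jacobson_quot_mulDl.

Lemma jacobson_quotM (x y : R) :
  \pi_jacobson_quot (x * y) = \pi_jacobson_quot x * \pi_jacobson_quot y.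
Proof. exact: jacobson_quot_piM. Qed.

End JacobsonQuotient.

(* Main.v *)
(* Both sides are equivalent to "a^2 - a is nilpotent for all a in R".

   If M_n(R) is UNC, then -1 is nil-clean, which forces 2 to be nilpotent. Since
   tr(A^2) = tr(A)^2 modulo 2, the trace of an idempotent E then satisfies
   "tr(E)^2 - tr(E) nilpotent" and the trace of a nilpotent matrix is nilpotent.
   A product of two transvections is a unit of arbitrary trace, so a^2 - a is
   nilpotent for every a.

   Conversely, every matrix is nil-clean. Idempotents lift along the surjection
   M_n(R) -> M_n(R/J(R)), whose kernel is nil. Over a Boolean ring, a finite
   orthogonal partition of 1 makes the entries of a given matrix 0 or 1 on each
   component. Over F_2 (here [bool]), a matrix is block triangular as soon as it
   has a proper nonzero stable subspace; otherwise it is similar to a companion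
   matrix, for which a decomposition is written down explicitly. *)
From HB Require Import structures.
Require Import Defs.
From mathcomp Require Import all_boot all_order all_algebra.
From mathcomp Require Import boolp classical_sets.
From mathcomp Require Import ring.

Set Implicit Arguments.
Unset Strict Implicit.
Unset Printing Implicit Defensive.

Import GRing.Theory.
Local Open Scope ring_scope.

(** * Nilpotent elements and the Jacobson radical *)

Lemma nilpotent_exp (S : pzRingType) (x : S) m :
  is_nilpotent (x ^+ m) -> is_nilpotent x.
Proof. by case=> k xmk0; exists (m * k)%N; rewrite exprM. Qed.

(** [x] and [b] may fail to commute, so there is no binomial expansion; instead the [m]-th power is
    a multiple of the central [z]. *)
Lemma nilpotent_centralMD (S : pzRingType) (z x b : S) :
  (forall y, z * y = y * z) -> is_nilpotent z -> is_nilpotent b ->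
  is_nilpotent (z * x + b).
Proof.
move=> zC [k zk0] [m bm0].
have [y zxbE] : exists y, (z * x + b) ^+ m = z * y + b ^+ m.
  elim: m {bm0} => [|m [y IHm]]; first by exists 0; rewrite mulr0 add0r.
  exists (x * (z * y + b ^+ m) + b * y).
  rewrite exprS IHm mulrDl [b * (_ + _)]mulrDr -exprS addrA; congr (_ + _).
  by rewrite [RHS]mulrDr !mulrA (zC b).
apply: (@nilpotent_exp _ _ m); exists k.
rewrite zxbE bm0 addr0 exprMn_comm ?zk0 ?mul0r //; exact: zC.
Qed.

Lemma nilpotentN (S : pzRingType) (x : S) : is_nilpotent x -> is_nilpotent (- x).
Proof. by case=> k xk0; exists k; rewrite exprNn xk0 mulr0. Qed.

Section Commutative.
Variable R : comPzRingType.

Lemma nilpotentMD (a x b : R) :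
  is_nilpotent a -> is_nilpotent b -> is_nilpotent (a * x + b).
Proof. by apply: nilpotent_centralMD => y; rewrite mulrC. Qed.

Lemma nilpotentD (a b : R) :
  is_nilpotent a -> is_nilpotent b -> is_nilpotent (a + b).
Proof. by rewrite -{2}[a]mulr1; exact: nilpotentMD. Qed.

Lemma nilpotentM (a x : R) : is_nilpotent a -> is_nilpotent (a * x).
Proof. by rewrite -[a * x]addr0 => /nilpotentMD; apply; exists 1; rewrite expr1. Qed.

Lemma nilpotent_subX_unit (a : R) : is_nilpotent a -> is_unit (1 - a).
Proof.
case=> k ak0; exists (\sum_(i < k) a ^+ i).
have E : (1 - a) * (\sum_(i < k) a ^+ i) = 1.
  by rewrite -opprB mulNr -subrX1 ak0 sub0r opprK.
by split; rewrite // mulrC.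
Qed.

Lemma ideal_unit (I : set R) (u : R) : left_ideal I -> is_unit u -> I u -> I = setT.
Proof.
move=> [_ _ IM] [v [_ vu]] Iu; apply/seteqP; split=> // x _.
by rewrite -[x]mulr1 -vu mulrA; apply: IM.
Qed.

Lemma left_ideal_addM (I : set R) (a : R) : left_ideal I ->
  left_ideal (fun x => exists y c, I y /\ x = y + c * a).
Proof.
move=> [I0 ID IM]; split=> [|x x'|b x].
- by exists 0, 0; rewrite mul0r addr0.
- move=> [y [c [Iy ->]]] [y' [c' [Iy' ->]]].
  by exists (y + y'), (c + c'); split; [exact: ID | ring].
- move=> [y [c [Iy ->]]].
  by exists (b * y), (b * c); split; [exact: IM | ring].
Qed.

(** A maximal [M] missing [a] would give [1 = y + c * a] with [y] in [M]; but [y = 1 - a * c] is a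
    unit. *)
Lemma nilpotent_jacobson (a : R) : is_nilpotent a -> jacobson R a.
Proof.
move=> a_nil M [idM /eqP MnT Mmax]; apply: contrapT => Ma.
have [M0 MD MM] := idM.
have := Mmax _ (left_ideal_addM a idM); case.
- by move=> x Mx; exists x, 0; rewrite mul0r addr0.
- move=> E; apply: Ma; rewrite -E; exists 0, 1; split=> //; ring.
move=> E; have : [set: R]%classic 1 by [].
rewrite -E => -[y [c [My e]]]; case/eqP: MnT.
apply: (ideal_unit idM) My.
have -> : y = 1 - a * c by rewrite e; ring.
exact/nilpotent_subX_unit/nilpotentM.
Qed.

Lemma maximal_ideal_exists (I : set R) : left_ideal I -> ~ I 1 ->
  exists M, maximal_left_ideal M /\ (I `<=` M)%classic.
Proof.
move=> idI I1.
pose P := [set X : set R | (I `<=` X)%classic /\ left_ideal X /\ ~ X 1]%classic.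
(* [Zorn_bigcup] also asks for the union of the empty chain, hence [set0]. *)
have [|M [PM Mmax]] := @Zorn_bigcup R (fun X => X = set0 \/ P X).
  move=> F FP Ftot.
  have [[X0 [FX0 PX0]]|F0] := pselect (exists X, F X /\ P X); last first.
    left; apply/seteqP; split=> // x [X FX Xx].
    case: (FP _ FX) => [X0|PX]; first by rewrite -X0.
    by case: F0; exists X.
  have [IX0 [[X00 _ _] _]] := PX0.
  have PF X x : F X -> X x -> P X.
    by move=> /FP [->|].
  right; split; first by move=> x Ix; exists X0 => //; exact: IX0.
  split; last by move=> [X FX X1]; case: (PF _ _ FX X1) => _ [_]; apply.
  split; first by exists X0.
  - move=> x y [X FX Xx] [Y FY Yy].
    have [_ [[_ XD _] _]] := PF _ _ FX Xx.
    have [_ [[_ YD _] _]] := PF _ _ FY Yy.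
    by case: (Ftot _ _ FX FY) => sub; [exists Y | exists X] => //;
      [apply: YD | apply: XD] => //; exact: sub.
  - move=> a x [X FX Xx]; exists X => //.
    by have [_ [[_ _ XM] _]] := PF _ _ FX Xx; exact: XM.
(* The empty set is not maximal: [I] lies strictly above it. *)
have {}PM : P M.
  case: PM => // M0; case: (Mmax I); last by right; split.
  rewrite M0; split; first exact: sub0set.
  by move=> /(_ 0); apply; case: idI.
have [IM [idM M1]] := PM; exists M; split=> //; split=> //.
  by move=> MT; apply: M1; rewrite MT.
move=> K idK MK; have [K1|K1] := pselect (K 1).
  by right; apply: (ideal_unit idK) K1; exists 1; rewrite mulr1.
left; apply: contrapT => KM; apply: (Mmax K).
  by split=> // KM'; apply: KM; apply/seteqP.
by right; split=> // x /IM /MK.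
Qed.

(** Otherwise the principal ideal of [1 - a] lies in a maximal ideal, which also contains [a] and
    hence [1]. *)
Lemma jacobson_sub1_unit (a : R) : jacobson R a -> is_unit (1 - a).
Proof.
move=> Ja; pose I x := exists c : R, x = c * (1 - a).
have idI : left_ideal I.
  split=> [|x y [c ->] [d ->]|b x [c ->]].
  - by exists 0; rewrite mul0r.
  - by exists (c + d); rewrite mulrDl.
  - by exists (b * c); rewrite mulrA.
have [[v v1]|I1] := pselect (I 1); first by exists v; rewrite [(1 - a) * v]mulrC.
have [M [maxM IM]] := maximal_ideal_exists idI I1.
have [idM MnT _] := maxM; have [_ MD _] := idM.
case: MnT; apply: (@ideal_unit _ 1) => //; first by exists 1; rewrite mulr1.
rewrite -[1](subrK a); apply: MD; last exact: Ja.
by apply: IM; exists 1; rewrite mul1r.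
Qed.

Lemma nil_jacobson : (forall a : R, is_nilpotent (a ^+ 2 - a)) ->
  nil_set (jacobson R).
Proof.
move=> Rnil a /jacobson_sub1_unit [v [av _]].
have -> : a = (a ^+ 2 - a) * - v by rewrite -[LHS]mulr1 -av; ring.
exact/nilpotentM/Rnil.
Qed.

Lemma Boolean_jacobson_quot : (forall a : R, is_nilpotent (a ^+ 2 - a)) ->
  Boolean_ring (jacobson_quot R).
Proof.
move=> Rnil x; rewrite -[x]generic_quotient.reprK /is_idempotent expr2.
rewrite -jacobson_quotM; apply/jacobson_quotP; rewrite -expr2.
exact: (nilpotent_jacobson (Rnil _)).
Qed.

(** * Traces of idempotent and nilpotent matrices *)

Lemma sum_sym_offdiag n (g : 'I_n -> 'I_n -> R) :
  (forall i j, g i j = g j i) -> (forall i, g i i = 0) ->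
  \sum_i \sum_j g i j = (\sum_(i < n) \sum_(j < n | (j < i)%N) g i j) *+ 2.
Proof.
move=> gC g0; rewrite mulr2n.
have -> : \sum_i \sum_j g i j =
    \sum_(i < n) (\sum_(j < n | (j < i)%N) g i j + \sum_(j < n | (i < j)%N) g i j).
  apply: eq_bigr => i _; rewrite (bigD1 i) //= g0 add0r.
  rewrite (bigID (fun j : 'I_n => (j < i)%N)) /=; congr (_ + _).
  - by apply: eq_bigl => j; rewrite -val_eqE /= neq_ltn; case: ltngtP.
  - by apply: eq_bigl => j; rewrite -val_eqE /= neq_ltn; case: ltngtP.
rewrite big_split /=; congr (_ + _).
rewrite (exchange_big_dep xpredT) //=.
by apply: eq_bigr => i _; apply: eq_bigr => j _; rewrite gC.
Qed.

(** The difference is the sum of all [A i j * A j i - A i i * A j j], symmetric in [i], [j] and zero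
    for [i = j], so its terms pair up. *)
Lemma mxtrace_sqr n (A : 'M[R]_n) : exists y, \tr (A ^+ 2) = (\tr A) ^+ 2 + y *+ 2.
Proof.
pose g i j := A i j * A j i - A i i * A j j.
exists (\sum_(i < n) \sum_(j < n | (j < i)%N) g i j); rewrite -sum_sym_offdiag /g.
- have -> : \tr (A ^+ 2) = \sum_i \sum_j A i j * A j i.
    by rewrite expr2; apply: eq_bigr => i _; rewrite mxE.
  rewrite expr2 /mxtrace mulr_suml -big_split /=; apply: eq_bigr => i _.
  by rewrite mulr_sumr -big_split /=; apply: eq_bigr => j _; rewrite addrC subrK.
- by move=> i j; ring.
- by move=> i; ring.
Qed.

Hypothesis nil2 : is_nilpotent (2%:R : R).

Lemma nilpotent_mulr2n (y : R) : is_nilpotent (y *+ 2).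
Proof. by rewrite -mulr_natl; exact: nilpotentM. Qed.

(** Up to a multiple of the nilpotent [2], squaring [N] squares its trace; an exponent [2 ^ k] lets
    the induction peel off one squaring at a time. *)
Lemma nilpotent_mxtrace n (N : 'M[R]_n) : is_nilpotent N -> is_nilpotent (\tr N).
Proof.
case=> k Nk0; have {Nk0} : N ^+ (2 ^ k) = 0.
  by rewrite -(subnK (ltnW (ltn_expl k (isT : (1 < 2)%N)))) exprD Nk0 mulr0.
elim: k N => [|k IHk] N; first by rewrite expr1 => ->; exists 1; rewrite mxtrace0 expr1.
rewrite expnS exprM => /IHk; have [y ->] := mxtrace_sqr N.
move=> /nilpotentD /(_ (nilpotentN (nilpotent_mulr2n y))).
by rewrite addrK; exact: nilpotent_exp.
Qed.

Lemma idempotent_mxtrace n (E : 'M[R]_n) : is_idempotent E ->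
  is_nilpotent ((\tr E) ^+ 2 - \tr E).
Proof.
move=> EE; have [y] := mxtrace_sqr E; rewrite EE => {2}->.
by rewrite opprD addNKr; exact/nilpotentN/nilpotent_mulr2n.
Qed.

End Commutative.

(** * Consequences of the UNC condition *)

Lemma nil_cleanN1 (S : pzRingType) : nil_clean (-1 : S) -> is_nilpotent (2%:R : S).
Proof.
case=> e [b [ee [k bk0] /eqP]]; rewrite addrC -subr_eq => /eqP bE.
(* Since [(1 - e) * e = 0], right multiplication by [b = -1 - e] negates [1 - e]; nilpotency of [b]
   then kills [1 - e], and [b = -2]. *)
have e1 : 1 - e = 0.
  have eb : (1 - e) * b = - (1 - e).
    rewrite -bE mulrBl mul1r mulrBr mulrN1 -expr2 ee.
    by rewrite opprD !opprK addrA subrK opprB addrC.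
  suff /(_ k) : forall m, (1 - e) * b ^+ m = (-1) ^+ m * (1 - e).
    rewrite bk0 mulr0 => /esym /(congr1 ( *%R ((-1) ^+ k))).
    by rewrite mulrA -expr2 sqrr_sign mul1r mulr0.
  elim=> [|m IHm]; first by rewrite !expr0 mulr1 mul1r.
  by rewrite exprSr mulrA IHm -mulrA eb mulrN exprS mulN1r mulNr.
exists k; apply: (can_inj (signrMK k)); rewrite mulr0 -bk0 -exprNn; congr (_ ^+ _).
by rewrite -bE -(subr0_eq e1) mulr2n opprD.
Qed.

Lemma is_unitM (S : pzRingType) (x y : S) : is_unit x -> is_unit y -> is_unit (x * y).
Proof.
move=> [x' [xx' x'x]] [y' [yy' y'y]]; exists (y' * x'); split.
- by rewrite mulrA -[x * y * y']mulrA yy' mulr1.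
- by rewrite mulrA -[y' * x' * x]mulrA x'x mulr1.
Qed.

Lemma is_unit_add1 (S : pzRingType) (d : S) : d * d = 0 -> is_unit (1 + d).
Proof.
move=> dd; exists (1 - d); split.
- by rewrite mulrDl mul1r mulrBr mulr1 dd subr0 subrK.
- by rewrite mulrBl mul1r mulrDr mulr1 dd addr0 addrK.
Qed.

(** For [i != j], the cross term [a E_ii] of [(1 + a E_ij)(1 + E_ji)] is the only term besides [1]
    that contributes to the trace. *)
Lemma unit_mx_trace (R : comPzRingType) n (a : R) : (2 <= n)%N ->
  exists2 U : 'M[R]_n, is_unit U & \tr U = n%:R + a.
Proof.
case: n => [|[|n]] // _; pose i : 'I_n.+2 := ord0; pose j : 'I_n.+2 := lift i ord0.
pose d : 'M[R]_n.+2 := a *: delta_mx i j; pose d' : 'M[R]_n.+2 := delta_mx j i.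
exists ((1 + d) * (1 + d')).
  apply: is_unitM; apply: is_unit_add1; rewrite -mulmxE.
    by rewrite -scalemxAl -scalemxAr mul_delta_mx_0 // !scaler0.
  by rewrite mul_delta_mx_0.
have tr_delta (k l : 'I_n.+2) : \tr (delta_mx k l : 'M[R]_n.+2) = (k == l)%:R.
  rewrite /mxtrace (bigD1 k) //= mxE eqxx big1 ?addr0 // => m mk.
  by rewrite mxE (negPf mk).
rewrite mulrDl mul1r mulrDr mulr1 -mulmxE -scalemxAl mul_delta_mx.
rewrite !mxtraceD mxtrace1 !mxtraceZ !tr_delta eqxx mulr1.
by rewrite [j == i]eq_sym mulr0 addr0 add0r.
Qed.

Lemma UNC_sqrB_nilpotent (R : comPzRingType) n : (2 <= n)%N ->
  UNC_ring 'M[R]_n -> forall a : R, is_nilpotent (a ^+ 2 - a).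
Proof.
move=> n2 unc a; have nil2 : is_nilpotent (2%:R : R).
  have /unc /nil_cleanN1 [k] : is_unit (-1 : 'M[R]_n).
    by exists (-1); rewrite mulrNN mulr1.
  move=> /matrixP /(_ (Ordinal (ltnW n2)) (Ordinal (ltnW n2))).
  by rewrite -natrX mulmxnE !mxE eqxx => e; exists k; rewrite -natrX.
(* The shift by [n] makes the trace of [U] equal to [a]. *)
have [U /unc [E [N [EE NN UE]]]] := unit_mx_trace (a - n%:R) n2.
rewrite addrC subrK UE mxtraceD => <-.
set t := \tr E; set s := \tr N.
have -> : (t + s) ^+ 2 - (t + s) = s * (t *+ 2 + s - 1) + (t ^+ 2 - t) by ring.
exact: nilpotentMD (nilpotent_mxtrace nil2 NN) (idempotent_mxtrace nil2 EE).
Qed.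

(** * Matrices over the field with two elements *)

Lemma nil_clean_conj (S : pzRingType) (u v a : S) :
  u * v = 1 -> v * u = 1 -> nil_clean (u * a * v) -> nil_clean a.
Proof.
move=> uv vu [e [b [ee [k bk0] uav]]].
have vXu m x : (v * x * u) ^+ m = v * x ^+ m * u.
  elim: m => [|m IHm]; first by rewrite !expr0 mulr1 vu.
  by rewrite !exprS IHm !mulrA -[_ * u * v]mulrA uv mulr1.
exists (v * e * u), (v * b * u); split.
- by rewrite /is_idempotent vXu ee.
- by exists k; rewrite vXu bk0 mulr0 mul0r.
- by rewrite -mulrDl -mulrDr -uav !mulrA vu mul1r -mulrA vu mulr1.
Qed.

Lemma exp_block_lower (R : pzRingType) r s (A : 'M[R]_r) (B : 'M[R]_(s, r))
    (D : 'M[R]_s) k :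
  exists X, (block_mx A 0 B D : 'M_(r + s)) ^+ k = block_mx (A ^+ k) 0 X (D ^+ k).
Proof.
elim: k => [|k [X IHk]]; first by exists 0; rewrite !expr0 -scalar_mx_block.
exists (B *m A ^+ k + D *m X).
by rewrite !exprS IHk -!mulmxE mulmx_block !mul0mx !mulmx0 !addr0 add0r.
Qed.

Lemma nil_clean_block_lower (R : pzRingType) r s (A : 'M[R]_r) (B : 'M[R]_(s, r))
    (D : 'M[R]_s) :
  nil_clean A -> nil_clean D -> nil_clean (block_mx A 0 B D : 'M_(r + s)).
Proof.
move=> [E1 [N1 [EE1 [k1 Nk1] ->]]] [E2 [N2 [EE2 [k2 Nk2] ->]]].
exists (block_mx E1 0 0 E2), (block_mx N1 0 B N2); split.
- rewrite /is_idempotent expr2 -mulmxE mulmx_block !mul0mx !mulmx0 !addr0 !add0r.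
  by rewrite !mulmxE -!expr2 EE1 EE2.
- have [X NX] := exp_block_lower N1 B N2 (k1 + k2).
  (* At exponent [k1 + k2] both diagonal blocks vanish, and what remains squares to zero. *)
  exists ((k1 + k2) * 2)%N; rewrite exprM {}NX [N1 ^+ _]exprD [N2 ^+ _]exprD.
  rewrite Nk1 Nk2 mul0r mulr0.
  by rewrite expr2 -mulmxE mulmx_block !mul0mx !mulmx0 !addr0 block_mx0.
- by rewrite add_block_mx !addr0 add0r.
Qed.

(** Matrices act on rows: in a basis of [U] followed by one of a complement, [A] is block lower
    triangular with diagonal blocks smaller than [n]. *)
Lemma nil_clean_stable (F : fieldType) n (U A : 'M[F]_n) :
  stablemx U A -> (0 < \rank U < n)%N ->
  (forall r, (r < n)%N -> forall B : 'M[F]_r, nil_clean B) -> nil_clean A.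
Proof.
move=> stU /andP[U_gt0 U_ltn] IH.
pose B1 := row_base U; pose B2 := row_base U^C%MS.
have rsE : (\rank U + \rank U^C)%N = n by rewrite mxrank_compl subnKC // ltnW.
have r_lt : (\rank U < n)%N by [].
have s_lt : (\rank U^C < n)%N.
  by rewrite mxrank_compl ltn_subrL U_gt0 (leq_ltn_trans _ U_ltn).
have stB1 : (B1 *m A <= B1)%MS by rewrite [stablemx _ _]stablemx_row_base.
have fullB : row_full (col_mx B1 B2).
  rewrite -sub1mx -addsmxE (adds_eqmx (eq_row_base _) (eq_row_base _)).
  by rewrite sub1mx addsmx_compl_full.
(* The ranks become variables, so that [n] can be replaced by [r + s] and [P] is square by its
   type. *)
clearbody B1 B2; move: B1 B2 rsE r_lt s_lt stB1 fullB.
move: (\rank U) (\rank U^C%MS) => r s B1 B2 rsE.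
move: rsE U A IH {stU U_gt0 U_ltn} B1 B2; case: n / => _ A IH B1 B2 r_lt s_lt.
case/submxP=> D B1A; rewrite row_full_unit => uP.
set P : 'M_(r + s) := col_mx B1 B2 in uP.
apply: (nil_clean_conj (mulmxV uP) (mulVmx uP)).
pose T : 'M_(s, r + s) := B2 *m A *m invmx P.
suff -> : P * A * invmx P = block_mx D 0 (lsubmx T) (rsubmx T).
  by apply: nil_clean_block_lower; exact: IH.
rewrite -!mulmxE; apply: (can_inj (mulmxK uP)); rewrite mulmxKV //.
rewrite [LHS]mul_col_mx block_mxEv hsubmxK mul_col_mx mulmxKV // B1A.
by rewrite mul_row_col mul0mx addr0.
Qed.

Lemma expmx_in_span (F : fieldType) n (A : 'M[F]_n.+1) :
  exists c : 'I_n.+1 -> F, A ^+ n.+1 = \sum_(i < n.+1) c i *: A ^+ i.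
Proof.
pose p := char_poly A; exists (fun i => - p`_i).
have pE : p = \sum_(i < n.+1) p`_i *: 'X^i + 'X^(n.+1).
  rewrite -{1}[p]coefK size_char_poly poly_def big_ord_recr /=.
  have /monicP := char_poly_monic A; rewrite /lead_coef size_char_poly /= => ->.
  by rewrite scale1r.
have := Cayley_Hamilton A; rewrite -/p {1}pE.
rewrite raddfD raddf_sum /= rmorphXn /= horner_mx_X => /eqP.
rewrite addrC addr_eq0 -sumrN => /eqP ->; apply: eq_bigr => i _.
by rewrite -mul_polyC rmorphM /= horner_mx_C rmorphXn /= horner_mx_X -mulmxE
           mul_scalar_mx scaleNr.
Qed.

(** Companion form for the action on rows; the last row, left free, holds the coefficients. *)
Definition shift_rows (F : fieldType) n (C : 'M[F]_n.+1) :=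
  forall k, (k < n)%N -> row (inord k) C = delta_mx 0 (inord k.+1).

(** The span of the [v *m A ^+ k] with [k <= n] is nonzero and, by Cayley-Hamilton, stable; hence
    these vectors form a basis. *)
Lemma irreducible_companion (F : fieldType) n (A : 'M[F]_n.+1) :
  (forall U : 'M[F]_n.+1, stablemx U A -> ~~ (0 < \rank U < n.+1)%N) ->
  exists P, P \in unitmx /\ shift_rows (P * A * invmx P).
Proof.
move=> irrA; pose v : 'rV[F]_n.+1 := delta_mx 0 0.
pose P : 'M[F]_n.+1 := \matrix_(k < n.+1) (v *m A ^+ k).
have rowE (k : 'I_n.+1) : row k P = v *m A ^+ k by rewrite rowK.
have vAP k : (k <= n)%N -> (v *m A ^+ k <= P)%MS.
  by rewrite -ltnS => lt_kn; rewrite -(rowE (Ordinal lt_kn)) row_sub.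
have rowPA (k : 'I_n.+1) : row k (P *m A) = v *m A ^+ k.+1.
  by rewrite row_mul rowE -mulmxA exprSr.
have stP : stablemx P A.
  apply/row_subP => k; rewrite rowPA.
  have [lt_kn|] := ltnP k n; first exact: vAP.
  rewrite leq_eqVlt ltnNge -ltnS ltn_ord orbF => /eqP <-.
  have [c ->] := expmx_in_span A; rewrite mulmx_sumr; apply: summx_sub => i _.
  by rewrite -scalemxAr scalemx_sub // vAP // -ltnS.
have P_gt0 : (0 < \rank P)%N.
  rewrite lt0n mxrank_eq0; apply/eqP => /(congr1 (row 0)).
  rewrite rowE expr0 mulmx1 row0 => /rowP /(_ 0).
  by rewrite !mxE !eqxx => /eqP; rewrite oner_eq0.
have uP : P \in unitmx.
  rewrite -row_full_unit /row_full eqn_leq rank_leq_col /= leqNgt.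
  by have := irrA _ stP; rewrite P_gt0.
exists P; split=> // k lt_kn.
rewrite -mulmxE row_mul rowPA inordK ?(leqW lt_kn) //.
have -> : v *m A ^+ k.+1 = row (inord k.+1) P by rewrite rowE inordK.
by rewrite -row_mul mulmxV // row1.
Qed.

(** The chain condition puts every basis vector in the span of the [e 0 *m N ^+ k], and [N ^+ n.+1]
    commutes with powers of [N]. *)
Lemma expmx_chain_eq0 (F : fieldType) n (N : 'M[F]_n.+1)
    (e : nat -> 'rV[F]_n.+1 := fun k => delta_mx 0 (inord k)) :
  e 0%N *m N ^+ n.+1 = 0 ->
  (forall k, (k <= n)%N -> e k = e 0%N *m N ^+ k \/
    exists2 j, (j < k)%N & e k = e 0%N *m N ^+ k + e j) ->
  N ^+ n.+1 = 0.
Proof.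
move=> N0 chain.
have N0k k : e 0%N *m N ^+ k *m N ^+ n.+1 = 0.
  by rewrite -mulmxA mulmxE -exprD addnC exprD -mulmxE mulmxA N0 mul0mx.
have eN k : (k <= n)%N -> e k *m N ^+ n.+1 = 0.
  elim/ltn_ind: k => k IHk le_kn.
  case: (chain k le_kn) => [|[j lt_jk]] ->; first exact: N0k.
  by rewrite mulmxDl N0k IHk ?addr0 // ltnW // (leq_trans lt_jk).
apply/row_matrixP => k; rewrite rowE row0.
by have := eN k; rewrite /e inord_val -ltnS; apply.
Qed.

Lemma addmxx_bool m n (A : 'M[bool]_(m, n)) : A + A = 0.
Proof. by apply/matrixP => i j; rewrite !mxE; exact: addbb. Qed.

Lemma oppmx_bool m n (A : 'M[bool]_(m, n)) : - A = A.
Proof. by apply/eqP; rewrite eq_sym -addr_eq0 addmxx_bool. Qed.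

(* With characteristic polynomial x^(n+1) = x^i + l, deg l < i, on the basis
   x^0, ..., x^n the idempotent is x^k |-> 0 for k < i, x^k |-> x^i for
   i <= k < n and x^n |-> x^n + l. *)
Lemma nil_clean_companion_bool n (C : 'M[bool]_n.+1) :
  shift_rows C -> nil_clean C.
Proof.
move=> Cshift; pose e k : 'rV[bool]_n.+1 := delta_mx 0 (inord k).
have eC k : (k < n)%N -> e k *m C = e k.+1 by move=> lt_kn; rewrite -rowE Cshift.
pose c := row ord_max C; have enC : e n *m C = c.
  by rewrite -rowE; congr row; apply/val_inj; rewrite /= inordK.
have eCX k : (k <= n)%N -> e 0%N *m C ^+ k = e k.
  elim: k => [|k IHk] lt_kn; first by rewrite mulmx1.
  by rewrite exprSr -mulmxE mulmxA IHk 1?ltnW // eC.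
have [c0|/rV0Pn[i1 ci1]] := eqVneq c 0.
  exists 0, C; split; rewrite ?add0r //; first by rewrite /is_idempotent expr0n.
  exists n.+1; apply: expmx_chain_eq0 => [|k /eCX eCXk]; last
    by left; rewrite -/(e 0%N) eCXk.
  by rewrite -/(e 0%N) exprSr -mulmxE mulmxA eCX // enC.
have [i ci i_max] := arg_maxnP (P := fun j => c 0 j != 0) (@nat_of_ord _) ci1.
(* In characteristic 2 this is [c] without its top term. *)
pose l := c + e i.
have lj (j : 'I_n.+1) : (i <= j)%N -> l 0 j = 0.
  rewrite leq_eqVlt !mxE inord_val eqxx /= => /orP[/eqP/val_inj <-|lt_ij].
    by move: ci; rewrite /c mxE eqxx; case: (C _ _).
  rewrite -val_eqE gtn_eqF // addr0; apply/eqP; apply: contraTT lt_ij => cj.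
  by rewrite -leqNgt; apply: i_max; rewrite mxE.
pose E : 'M[bool]_n.+1 := \matrix_(k < n.+1)
  if (k < i)%N then 0 else if (k < n)%N then e i else e n + l.
have eE k : (k <= n)%N ->
    e k *m E = if (k < i)%N then 0 else if (k < n)%N then e i else e n + l.
  by move=> le_kn; rewrite -rowE rowK inordK.
(* [l] is supported below [i], where the rows of [E] vanish; hence [E] fixes [e n + l]. *)
have lE : l *m E = 0.
  rewrite mulmx_sum_row big1 // => j _; rewrite rowK.
  by case: ltnP => [_|/lj ->]; rewrite ?scaler0 ?scale0r.
have le_in : (i <= n)%N by rewrite -ltnS.
have enE : e n *m E = e n + l by rewrite eE // ltnn ltnNge le_in.
exists E, (C - E); split; last by rewrite addrC subrK.
  apply/row_matrixP => k; rewrite expr2 -mulmxE row_mul !rowK.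
  case: ltnP => [_|le_ik]; first by rewrite mul0mx.
  case: ltnP => [lt_kn|_]; last by rewrite mulmxDl enE lE addr0.
  by rewrite eE // ltnn (leq_ltn_trans le_ik).
set N := C - E; have eN k : e k *m N = e k *m C + e k *m E.
  by rewrite /N mulmxBr oppmx_bool.
(* [N] sends [e k] to [e k.+1] for [k < i] and to [e k.+1 + e i] for [i <= k < n]; on [e k + e k.-1]
   with [i < k < n] the two copies of [e i] cancel. *)
have eNX k : (k <= n)%N -> e 0%N *m N ^+ k = e k + (if (k <= i)%N then 0 else e k.-1).
  elim: k => [|k IHk] lt_kn; first by rewrite mulmx1 addr0.
  rewrite exprSr -mulmxE mulmxA (IHk (ltnW lt_kn)) mulmxDl eN eC //=.
  rewrite eE ?(ltnW lt_kn) //.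
  rewrite lt_kn; case: (ltngtP k i) => [lt_ki|lt_ik|->].
  - by rewrite mul0mx addr0.
  - have lt_k1n : (k.-1 < n)%N by rewrite (leq_ltn_trans (leq_pred _)).
    have k0 : (0 < k)%N by rewrite (leq_trans _ lt_ik).
    rewrite eN eC // prednK // eE ?(ltnW lt_k1n) // lt_k1n.
    rewrite ltnNge -ltnS prednK // lt_ik /=.
    by rewrite [e k + e i]addrC addrA -[_ + e i + e i]addrA addmxx_bool addr0.
  - by rewrite mul0mx addr0.
exists n.+1; apply: expmx_chain_eq0 => [|k le_kn]; rewrite -!/(e _).
  rewrite exprSr -mulmxE mulmxA eNX // mulmxDl eN enC enE.
  (* Thus [e n *m N = e n + e i], and the last step of the chain gives zero. *)
  have -> : c + (e n + l) = e n + e i.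
    by rewrite /l addrCA [c + l]addrA addmxx_bool add0r.
  have [le_ni|lt_in] := leqP n i.
    by rewrite mul0mx addr0 (@anti_leq i n) ?le_in // addmxx_bool.
  have n0 : (0 < n)%N by rewrite (leq_ltn_trans _ lt_in).
  rewrite eN eC prednK // eE ?leq_pred // prednK // leqnn.
  by rewrite leqNgt lt_in addmxx_bool.
rewrite eNX //; case: leqP => [_|lt_ik]; first by left; rewrite addr0.
right; exists k.-1; first by rewrite ltn_predL (leq_trans _ lt_ik).
by rewrite -addrA addmxx_bool addr0.
Qed.

Lemma nil_clean_bool n (A : 'M[bool]_n) : nil_clean A.
Proof.
elim/ltn_ind: n A => -[|n] IHn A.
  exists 0, 0; split; [exact: expr0n | by exists 1; rewrite expr1 |].
  by apply/matrixP => -[].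
have [[U [stU rkU]]|irrA] :=
    pselect (exists U : 'M_n.+1, stablemx U A /\ (0 < \rank U < n.+1)%N).
  exact: nil_clean_stable stU rkU IHn.
have [|P [uP shiftP]] := @irreducible_companion _ _ A.
  by move=> U stU; apply/negP => rkU; apply: irrA; exists U.
apply: (nil_clean_conj (mulmxV uP) (mulVmx uP)).
exact: nil_clean_companion_bool.
Qed.

(** * Boolean rings and lifting *)

Lemma scalemx_exp_eq (R : comPzRingType) n (a : R) (X Y : 'M[R]_n) m :
  a *: X = a *: Y -> a *: X ^+ m = a *: Y ^+ m.
Proof.
move=> aXY; elim: m => // m IHm; rewrite !exprS -!mulmxE.
by rewrite scalemxAl aXY -scalemxAl scalemxAr IHm -scalemxAr.
Qed.

Section Glue.
Variables (R : comPzRingType) (n : nat) (T : finType) (f : T -> R).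
Hypotheses (f_sum : \sum_t f t = 1) (f_idem : forall t, f t * f t = f t).
Hypothesis f_orth : forall s t, s != t -> f s * f t = 0.

Lemma scalemx_eq_glue (X Y : 'M[R]_n) : (forall t, f t *: X = f t *: Y) -> X = Y.
Proof.
move=> fXY; rewrite -[X]scale1r -[Y]scale1r -f_sum !scaler_suml.
by apply: eq_bigr => t _; exact: fXY.
Qed.

Lemma scalemx_glue (X : T -> 'M[R]_n) t : f t *: (\sum_s f s *: X s) = f t *: X t.
Proof.
rewrite scaler_sumr (bigD1 t) //= scalerA f_idem big1 ?addr0 // => s st.
by rewrite scalerA f_orth ?scale0r // eq_sym.
Qed.

(** The orthogonal idempotents [f t] split the matrix ring into components on which equations may be
    checked; as [T] is finite, one exponent serves all nilpotent parts. *)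
Lemma nil_clean_glue (A : 'M[R]_n) (X : T -> 'M[R]_n) :
  (forall t, f t *: A = f t *: X t) -> (forall t, nil_clean (X t)) -> nil_clean A.
Proof.
move=> fAX cleanX.
have /choice[Y] : forall t, exists Y : 'M[R]_n * 'M[R]_n * nat,
    [/\ is_idempotent Y.1.1, Y.1.2 ^+ Y.2 = 0 & X t = Y.1.1 + Y.1.2].
  by move=> t; have [e [b [ee [k bk0] ->]]] := cleanX t; exists (e, b, k).
move=> YP; exists (\sum_t f t *: (Y t).1.1), (\sum_t f t *: (Y t).1.2); split.
- apply: scalemx_eq_glue => t; rewrite (scalemx_exp_eq 2 (scalemx_glue _ t)).
  by rewrite scalemx_glue; case: (YP t) => ->.
- exists (\max_t (Y t).2); apply: scalemx_eq_glue => t.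
  rewrite (scalemx_exp_eq _ (scalemx_glue _ t)) scaler0.
  have /subnK <- : ((Y t).2 <= \max_t (Y t).2)%N by exact: leq_bigmax.
  by rewrite exprD; case: (YP t) => _ ->; rewrite mulr0 scaler0.
- by apply: scalemx_eq_glue => t; rewrite scalerDr !scalemx_glue -scalerDr fAX;
    case: (YP t) => _ _ ->.
Qed.

End Glue.

Lemma nil_clean_rmorph (S S' : pzRingType) (f : {rmorphism S -> S'}) a :
  nil_clean a -> nil_clean (f a).
Proof.
move=> [e [b [ee [k bk0] ->]]]; exists (f e), (f b); split.
- by rewrite /is_idempotent -rmorphXn ee.
- by exists k; rewrite -rmorphXn bk0 rmorph0.
- by rewrite rmorphD.
Qed.

Lemma Boolean_char2 (B : comPzRingType) : Boolean_ring B -> (2%:R : B) = 0.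
Proof.
move=> Bool; have := Bool 2%:R; rewrite /is_idempotent => e.
by rewrite -[LHS](addrK 2%:R) -[X in _ - X]e; ring.
Qed.

Section BoolMorphism.
Variables (B : comPzRingType) (BB : Boolean_ring B).

(* The proof argument only lets the morphism instances below be inferred. *)
Definition bool_inj of Boolean_ring B := fun b : bool => b%:R : B.

Fact bool_inj_zmod_morphism : zmod_morphism (bool_inj BB).
Proof.
move=> [] []; rewrite /bool_inj /= ?subrr ?subr0 //.
by apply/eqP; rewrite sub0r -subr_eq0 opprK -mulr2n Boolean_char2.
Qed.

Fact bool_inj_monoid_morphism : monoid_morphism (bool_inj BB).
Proof. by split=> // -[] []; rewrite /bool_inj /= ?mulr1 ?mulr0 ?mul0r. Qed.

HB.instance Definition _ :=
  GRing.isZmodMorphism.Build bool B (bool_inj BB) bool_inj_zmod_morphism.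
HB.instance Definition _ :=
  GRing.isMonoidMorphism.Build bool B (bool_inj BB) bool_inj_monoid_morphism.
End BoolMorphism.

Lemma nil_clean_Boolean (B : comPzRingType) n (A : 'M[B]_n) :
  Boolean_ring B -> nil_clean A.
Proof.
move=> BB; have BB2 (x : B) : x * x = x by rewrite -expr2 BB.
have B0 (x : B) : x * (1 - x) = 0 by rewrite mulrBr mulr1 BB2 subrr.
pose g (p : 'I_n * 'I_n) (b : bool) := if b then A p.1 p.2 else 1 - A p.1 p.2.
(* [f S] is the idempotent of the component on which [A] has the pattern [S]. *)
pose f (S : {ffun 'I_n * 'I_n -> bool}) := \prod_p g p (S p).
pose M (S : {ffun 'I_n * 'I_n -> bool}) : 'M_n := \matrix_(i, j) S (i, j).
apply: (@nil_clean_glue _ _ _ f _ _ _ _ (fun S => map_mx (bool_inj BB) (M S))).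
(* Expanding the product over all entries [x] of [x + (1 - x) = 1] gives the sum of all [f S]. *)
- rewrite -(bigA_distr_bigA g) big1 // => p _.
  by rewrite big_bool /= addrC subrK.
- by move=> S; exact: BB2.
- move=> S T ST.
  have [p Sp] : exists p, S p != T p.
    by apply/existsP; apply: contraNT ST; rewrite negb_exists => /forallP ST;
       apply/eqP/ffunP => p; apply/eqP; have := ST p; rewrite negbK.
  rewrite /f (bigD1 p) // [X in _ * X](bigD1 p) //= mulrACA.
  suff -> : g p (S p) * g p (T p) = 0 by rewrite mul0r.
  by rewrite /g; case: (S p) (T p) Sp => -[] //= _; rewrite 1?mulrC B0.
(* The factor of [f S] at [(i, j)] turns the entry [A i j] into [1] or [0], as [S] prescribes. *)
- move=> S; apply/matrixP => i j; rewrite !mxE /f (bigD1 (i, j)) //=.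
  rewrite [LHS]mulrAC [RHS]mulrAC; congr (_ * _).
  rewrite /g /bool_inj /=; case: (S _) => /=; first by rewrite mulr1.
  by rewrite mulr0 mulrC B0.
- by move=> S; apply: nil_clean_rmorph; exact: nil_clean_bool.
Qed.

(* This idempotent is a multiple of x^k and its complement one of (1 - x)^k. *)
Lemma idempotent_subX (S : pzRingType) (x : S) k :
  (x * (1 - x)) ^+ k = 0 -> is_idempotent (1 - (1 - x ^+ k) ^+ k).
Proof.
move=> xk0; set e := 1 - _.
have eE : e = x ^+ k * \sum_(i < k) (1 - x ^+ k) ^+ i.
  by rewrite /e -opprB subrX1 addrAC subrr add0r mulNr opprK.
pose s := \sum_(i < k) x ^+ i.
have comm_xs : GRing.comm s (1 - x).
  apply: commrB; first exact: commr1.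
  by apply: commr_sym; apply: commr_sum => i _; apply: commrX.
have e1E : 1 - e = s ^+ k * (1 - x) ^+ k.
  rewrite /e opprB addrC subrK -exprMn_comm //; congr (_ ^+ _).
  by rewrite comm_xs -[LHS]opprB subrX1 -mulNr opprB.
have xC : (1 - x) * x = x * (1 - x) by rewrite mulrBl mulrBr mul1r mulr1.
have : (1 - e) * e = 0.
  rewrite e1E eE mulrA -[s ^+ k * _ * _]mulrA -exprMn_comm //.
  by rewrite xC xk0 mulr0 mul0r.
by rewrite mulrBl mul1r -expr2 => /subr0_eq eE2; rewrite /is_idempotent -eE2.
Qed.

(** For a lift [x] of [e], [x * (1 - x)] lies in the nil kernel, so [idempotent_subX] yields an
    idempotent, which still maps to [e]. Subtracting it from [a] leaves an element whose [m]-th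
    power is in the kernel. *)
Lemma nil_clean_lift (S S' : pzRingType) (f : {rmorphism S -> S'}) (a : S) :
  (forall y, exists x, f x = y) -> (forall x, f x = 0 -> is_nilpotent x) ->
  nil_clean (f a) -> nil_clean a.
Proof.
move=> f_surj f_nil [e [b [ee [m bm0] fa]]].
have [x fx] := f_surj e.
have [k xk0] : is_nilpotent (x * (1 - x)).
  by apply: f_nil; rewrite rmorphM rmorphB rmorph1 fx mulrBr mulr1 -expr2 ee subrr.
have idemX (y : S') l : is_idempotent y -> y ^+ l.+1 = y.
  by move=> yy; elim: l => [|l IHl]; rewrite ?expr1 // exprS IHl -expr2 yy.
(* The exponent must be positive for powers of [e] and [1 - e] to collapse. *)
have fE : f (1 - (1 - x ^+ k.+1) ^+ k.+1) = e.
  have e1 : is_idempotent (1 - e).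
    by rewrite /is_idempotent expr2 mulrBl mul1r mulrBr mulr1 -expr2 ee subrr subr0.
  rewrite rmorphB rmorphXn rmorphB rmorphXn rmorph1 fx (idemX e) // (idemX (1 - e)) //.
  by rewrite opprB addrC subrK.
exists (1 - (1 - x ^+ k.+1) ^+ k.+1), (a - (1 - (1 - x ^+ k.+1) ^+ k.+1)); split.
- by apply: idempotent_subX; rewrite exprSr xk0 mul0r.
- apply: (@nilpotent_exp _ _ m); apply: f_nil.
  by rewrite rmorphXn rmorphB fE fa addrC addKr.
- by rewrite addrC subrK.
Qed.

(** Each term of [A] is a central nilpotent scalar matrix times a matrix unit, so
    [nilpotent_centralMD] adds them one by one. *)
Lemma nilpotent_mx (R : comPzRingType) n (A : 'M[R]_n) :
  (forall i j, is_nilpotent (A i j)) -> is_nilpotent A.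
Proof.
move=> Anil; rewrite [A]matrix_sum_delta pair_bigA /=.
elim/big_rec: _ => [|[i j] b _ b_nil]; first by exists 1; rewrite expr1.
rewrite -mul_scalar_mx mulmxE; apply: nilpotent_centralMD => // [y|].
  by rewrite -mulmxE scalar_mxC.
by have [k ak0] := Anil i j; exists k; rewrite -rmorphXn /= ak0 raddf0.
Qed.

(** * Reduction modulo the Jacobson radical *)

Section JacobsonMorphism.
Variable R : comPzRingType.

Definition jacobson_pi (x : R) : jacobson_quot R := (\pi_(jacobson_quot R) x)%qT.

Fact jacobson_pi_zmod_morphism : zmod_morphism jacobson_pi.
Proof.
move=> x y; apply: (addIr (jacobson_pi y)); rewrite subrK.
by rewrite /jacobson_pi -jacobson_quotD subrK.
Qed.

Fact jacobson_pi_monoid_morphism : monoid_morphism jacobson_pi.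
Proof. by split=> // x y; exact: jacobson_quotM. Qed.

HB.instance Definition _ := GRing.isZmodMorphism.Build R (jacobson_quot R)
  jacobson_pi jacobson_pi_zmod_morphism.
HB.instance Definition _ := GRing.isMonoidMorphism.Build R (jacobson_quot R)
  jacobson_pi jacobson_pi_monoid_morphism.

Lemma jacobson_pi_eq0 x : jacobson_pi x = 0 -> jacobson R x.
Proof. by rewrite -(rmorph0 jacobson_pi) => /jacobson_quotP; rewrite subr0. Qed.

End JacobsonMorphism.

Lemma nil_clean_nil_Boolean (R : comPzRingType) n (A : 'M[R]_n) :
  nil_set (jacobson R) -> Boolean_ring (jacobson_quot R) -> nil_clean A.
Proof.
move=> Jnil BJ; apply: (@nil_clean_lift _ _ (map_mx (@jacobson_pi R))).
- move=> Y; exists (map_mx generic_quotient.repr Y); apply/matrixP => i j.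
  by rewrite !mxE; exact: generic_quotient.reprK.
- move=> X /matrixP X0; apply: nilpotent_mx => i j; apply: (Jnil _ (jacobson_pi_eq0 _)).
  by have := X0 i j; rewrite !mxE.
- exact: nil_clean_Boolean.
Qed.

Theorem theorem2p16 (R : comPzRingType) (n : nat) (hn : (2 <= n)%N) :
  UNC_ring 'M[R]_n <->
  (nil_set (jacobson R) /\ Boolean_ring (jacobson_quot R)).
Proof.
split=> [/(UNC_sqrB_nilpotent hn) sqrB|[Jnil BJ] U _].
  by split; [exact: nil_jacobson | exact: Boolean_jacobson_quot].
exact: nil_clean_nil_Boolean.
Qed.
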